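(* Let $(\Omega,\mathcal F,\mathsf P)$ be a probability space with random variable $x$, and let $\mathcal H$ be a finite-dimensional Hilbert space. For each $x$ let $H(x)=\sum_{j=1}^{N_B}E_j(x)\Pi_j(x)$ be a self-adjoint operator on $\mathcal H$ written via its spectral resolution, with $N_B$ independent of $x$, distinct eigenvalues $E_1(x),\dots,E_{N_B}(x)$ and spectral projectors $\Pi_j(x)$. Let $\rho\ge 0$ be a positive operator (not necessarily normalized) and set $d_j(x)=\operatorname{tr}(\rho\,\Pi_j(x))$ and $\chi_x(t)=\operatorname{tr}(\rho e^{-itH(x)})=\sum_{j=1}^{N_B}d_j(x)e^{-itE_j(x)}$. Assume: (i) the law of the eigenvalue vector $\boldsymbol E(x)=(E_1(x),\dots,E_{N_B}(x))$ is absolutely continuous with respect to Lebesgue measure on $\mathbb R^{N_B}$; (ii) $\operatorname{tr}\Pi_j(x)$ and $d_j(x)$ do not depend on $x$. Then for every $m\in\mathbb N$ the limit $\lim_{t\to\infty}\mathsf E_x[|\chi_x(t)|^{2m}]$ exists and $$\lim_{t\to\infty}\mathsf E_x\big[|\chi_x(t)|^{2m}\big]=\overline{\mathsf E_x\big[|\chi_x(t)|^{2m}\big]}=\mathsf E_x\Big[\overline{|\chi_x(t)|^{2m}}\Big]=\overline{|\chi_x(t)|^{2m}},$$ where the last equality holds for almost every realization $x$ (in particular $\overline{|\chi_x(t)|^{2m}}$ is almost surely independent of $x$).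
   Context: For a function $f$ of time, $\overline{f(t)}:=\lim_{T\to\infty}\frac1T\int_0^T f(t)\,dt$ (infinite time average). $\mathsf E_x$ denotes expectation over the random variable $x$. *)

(* Defs.v *)
From HB Require Import structures.
From mathcomp Require Import all_boot all_order all_algebra.
From mathcomp Require Import all_classical all_reals all_analysis.
From mathcomp Require Import complex.

Set Implicit Arguments.
Unset Strict Implicit.
Unset Printing Implicit Defensive.

Import Order.TTheory GRing.Theory Num.Theory.
Import numFieldNormedType.Exports.

Local Open Scope classical_set_scope.
Local Open Scope ring_scope.
Local Open Scope complex_scope.

Section Defs.
Variable R : realType.
Local Notation C := (complex R).

Definition adjmx (m n : nat) (A : 'M[C]_(m, n)) : 'M[C]_(n, m) :=
  (map_mx (@conjc R) A)^T.

Definition hermitian (n : nat) (A : 'M[C]_n) : Prop := adjmx A = A.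

Definition psd (n : nat) (A : 'M[C]_n) : Prop :=
  forall v : 'cV[C]_n, 0 <= (adjmx v *m A *m v) 0 0.

Definition orth_proj (n : nat) (P : 'M[C]_n) : Prop :=
  hermitian P /\ P *m P = P.

Definition spectral_resolution (n NB : nat) (H : 'M[C]_n)
  (E : 'I_NB -> R) (Pi : 'I_NB -> 'M[C]_n) : Prop :=
  [/\ injective E,
      forall j, orth_proj (Pi j) /\ Pi j != 0,
      forall j k, j != k -> Pi j *m Pi k = 0,
      \sum_j Pi j = 1%:M
    & H = \sum_j (E j)%:C *: Pi j].

Definition expi (theta : R) : C := (cos theta) +i* (sin theta).

(* e^{-itH} for H = sum_j E_j Pi_j, defined by the functional calculus *)
Definition evol (n NB : nat) (E : 'I_NB -> R) (Pi : 'I_NB -> 'M[C]_n) (t : R)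
  : 'M[C]_n := \sum_j expi (- (t * E j)) *: Pi j.

Definition chi (n NB : nat) (rho : 'M[C]_n) (E : 'I_NB -> R)
  (Pi : 'I_NB -> 'M[C]_n) (t : R) : C := \tr (rho *m evol E Pi t).

Definition cabs_pow (z : C) (k : nat) : R := complex.Re (`|z| ^+ k).

Definition tavg_T (f : R -> R) (T : R) : R :=
  T^-1 * Rintegral lebesgue_measure `[0, T] f.

Definition tavg (f : R -> R) : R := lim (tavg_T f T @[T --> +oo]).

Definition box (N : nat) (a b : N.-tuple R) : set (N.-tuple R) :=
  [set v | forall i, tnth a i <= tnth v i <= tnth b i].
Definition box_vol (N : nat) (a b : N.-tuple R) : R :=
  \prod_(i < N) (tnth b i - tnth a i).
Definition lebesgue_null (N : nat) (A : set (N.-tuple R)) : Prop :=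
  forall eps : R, 0 < eps ->
  exists (a b : nat -> N.-tuple R),
    [/\ forall k i, tnth (a k) i <= tnth (b k) i,
        A `<=` \bigcup_k box (a k) (b k)
      & forall K, \sum_(0 <= k < K) box_vol (a k) (b k) < eps].

End Defs.

(* Main.v *)
Require Import Defs.
From HB Require Import structures.
From mathcomp Require Import all_boot all_order all_algebra.
From mathcomp Require Import all_classical all_reals all_analysis.
From mathcomp Require Import measurable_realfun complex.
From mathcomp Require Import ring lra.

(* Since |chi|^2 = (Re chi)^2 + (Im chi)^2 and products of cosines are sums of
   cosines, |chi_x(t)|^{2m} = sum_k A_k cos(t (c_k . E(x)) + phi_k) with constants
   A_k, phi_k and frequency vectors c_k that do not depend on x.  The common value
   of the four quantities is L = sum_{k : c_k = 0} A_k cos phi_k.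
   If c <> 0, the law of c . E is absolutely continuous on R: the preimage of a
   Lebesgue-null set under v |-> c . v is covered by boxes of small total volume.
   So almost surely c_k . E(x) <> 0 whenever c_k <> 0, which gives the time
   averages, while Radon-Nikodym and the Riemann-Lebesgue lemma give
   E_x[cos(t (c . E) + phi)] -> 0, hence the limit of the expectation, and its
   Cesaro mean. *)

Import Order.TTheory GRing.Theory Num.Theory.
Import numFieldNormedType.Exports.

Local Open Scope classical_set_scope.
Local Open Scope ring_scope.

Set Implicit Arguments.
Unset Strict Implicit.
Unset Printing Implicit Defensive.

Lemma cvg_lin_comb {R : realType} {T I : Type} (F : set_system T) {FF : Filter F}
    (r : seq I) (c l : I -> R) (f : I -> T -> R) :
  (forall i, f i x @[x --> F] --> l i) ->
  \sum_(i <- r) c i * f i x @[x --> F] --> \sum_(i <- r) c i * l i.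
Proof.
move=> fl; elim: r => [|i r IH].
  rewrite big_nil (_ : (fun x => \sum_(j <- [::]) c j * f j x) = cst 0).
    exact: cvg_cst.
  by apply/funext => x; rewrite big_nil.
rewrite big_cons (_ : (fun x => \sum_(j <- i :: r) c j * f j x) =
    (fun x => c i * f i x + \sum_(j <- r) c j * f j x)).
  by apply: cvgD IH; apply: cvgM (fl i); exact: cvg_cst.
by apply/funext => x; rewrite big_cons.
Qed.

Section LinComb.
Context {d} {T : measurableType d} {R : realType}.
Variables (mu : {measure set T -> \bar R}) (D : set T).
Hypothesis mD : measurable D.
Variables (I : Type) (c : I -> R) (g : I -> T -> R).
Hypothesis gi : forall i, mu.-integrable D (EFin \o g i).

Lemma integrable_lin_comb (r : seq I) :
  mu.-integrable D (EFin \o (fun x => \sum_(i <- r) c i * g i x)).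
Proof.
elim: r => [|i r IH].
  rewrite (_ : _ \o _ = cst 0%E); first exact: integrable0.
  by apply/funext => x /=; rewrite big_nil.
rewrite (_ : _ \o _ = (fun x => (c i)%:E * (EFin \o g i) x) \+
    (EFin \o (fun x => \sum_(j <- r) c j * g j x)%R))%E.
  by apply: integrableD => //; exact: integrableZl.
by apply/funext => x /=; rewrite big_cons EFinD EFinM.
Qed.

Lemma Rintegral_lin_comb (r : seq I) :
  \int[mu]_(x in D) (\sum_(i <- r) c i * g i x) =
  \sum_(i <- r) c i * \int[mu]_(x in D) g i x.
Proof.
elim: r => [|i r IH].
  rewrite big_nil -[RHS](mul0r (fine (mu D))) -Rintegral_cst //.
  by apply: eq_Rintegral => x _; rewrite big_nil.
rewrite big_cons -IH -RintegralZl // -RintegralD //.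
- by apply: eq_Rintegral => x _; rewrite big_cons.
- rewrite (_ : _ \o _ = fun x => (c i)%:E * (EFin \o g i) x)%E //.
  exact: integrableZl.
- exact: integrable_lin_comb.
Qed.

End LinComb.

(** * Null sets in R^N *)

Lemma sum_nat_inj_le {R : realDomainType} (f : nat -> nat * nat)
    (v : nat -> nat -> R) (e : nat -> R) (c : R) :
  injective f -> (forall i j, 0 <= v i j) ->
  (forall i K, \sum_(0 <= j < K) v i j <= e i) ->
  (forall K, \sum_(0 <= i < K) e i <= c) ->
  forall K, \sum_(0 <= k < K) v (f k).1 (f k).2 <= c.
Proof.
move=> finj v0 ve ec K.
have [M fM] : exists M, forall k, (k < K)%N -> ((f k).1 < M)%N /\ ((f k).2 < M)%N.
  elim: K => [|K [M IH]]; first by exists 0%N.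
  exists (maxn M (maxn (f K).1.+1 (f K).2.+1)) => k.
  rewrite ltnS leq_eqVlt => /orP[/eqP ->|/IH[h1 h2]].
    by rewrite !leq_max !leqnn !orbT.
  by rewrite !leq_max h1 h2.
have -> : \sum_(0 <= k < K) v (f k).1 (f k).2 =
    \sum_(x <- [seq f k | k <- index_iota 0 K]) v x.1 x.2 by rewrite big_map.
apply: (@le_trans _ _ (\sum_(0 <= i < M) \sum_(0 <= j < M) v i j)).
  have -> : \sum_(0 <= i < M) \sum_(0 <= j < M) v i j =
      \sum_(x <- [seq (i, j) | i <- index_iota 0 M, j <- index_iota 0 M]) v x.1 x.2.
    by rewrite big_allpairs_dep.
  set s := [seq f k | k <- _]; set t := [seq (i, j) | i <- _, j <- _].
  have us : uniq s by rewrite map_inj_uniq ?iota_uniq.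
  have ut : uniq t.
    by apply: allpairs_uniq; rewrite ?iota_uniq// => -[? ?] [? ?] _ _ /= [-> ->].
  have st : {subset s <= t}.
    move=> x /mapP[k]; rewrite mem_index_iota /= => kK ->.
    have [h1 h2] := fM k kK.
    by apply/allpairsP; exists (f k); rewrite !mem_index_iota; split => //; case: (f k).
  have pst : perm_eq s [seq x <- t | x \in s].
    apply: uniq_perm => //; first exact: filter_uniq.
    by move=> x; rewrite mem_filter; case: (boolP (x \in s)) => // /st ->.
  rewrite (perm_big _ pst) big_filter [leRHS](bigID (mem s)) /= lerDl.
  by apply: sumr_ge0 => x _; exact: v0.
apply: le_trans (ec M); apply: ler_sum => i _; exact: ve.
Qed.

Lemma sum_geometric_le {R : realFieldType} (e : R) (K : nat) : 0 <= e ->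
  \sum_(0 <= k < K) e / 2 ^+ k.+1 <= e.
Proof.
move=> e0; suff -> : \sum_(0 <= k < K) e / 2 ^+ k.+1 = e - e / 2 ^+ K.
  by rewrite gerBl divr_ge0 ?exprn_ge0.
elim: K => [|K IH]; first by rewrite big_nil expr0 divr1 subrr.
rewrite big_nat_recr //= IH exprS.
by field; rewrite expf_neq0.
Qed.

Section Covers.
Context {R : realType} {N : nat}.
Implicit Types (A B : set (N.-tuple R)) (c : 'rV[R]_N) (v : N.-tuple R).

Definition covers A (e : R) : Prop := exists (a b : nat -> N.-tuple R),
  [/\ forall k i, tnth (a k) i <= tnth (b k) i,
      A `<=` \bigcup_k box (a k) (b k)
    & forall K, \sum_(0 <= k < K) box_vol (a k) (b k) <= e].

Lemma covers_null A : (forall e, 0 < e -> covers A e) -> lebesgue_null A.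
Proof.
move=> cA e e0; have [|a [b [ab Aab vab]]] := cA (e / 2).
  by rewrite divr_gt0.
exists a, b; split=> // K; apply: le_lt_trans (vab K) _.
by rewrite ltr_pdivrMr ?ltr_pMr // ltr1n.
Qed.

Lemma covers_sub A B e e' : A `<=` B -> e <= e' -> covers B e -> covers A e'.
Proof.
move=> AB ee' [a [b [ab Bab vab]]]; exists a, b; split=> //.
  exact: subset_trans Bab.
by move=> K; apply: le_trans (vab K) ee'.
Qed.

Lemma covers_bigcup (A : nat -> set (N.-tuple R)) (e : nat -> R) (s : R) :
  (forall k, covers (A k) (e k)) -> (forall K, \sum_(0 <= k < K) e k <= s) ->
  covers (\bigcup_k A k) s.
Proof.
move=> /choice[a /choice[b ab]] es.
have /card_set_bijP[f [_ finj fsurj]] : ([set: nat] #= [set: nat * nat])%card.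
  by rewrite card_eq_sym card_nat2.
have {}finj : injective f by move=> x y; apply: finj; rewrite inE.
exists (fun n => a (f n).1 (f n).2), (fun n => b (f n).1 (f n).2); split.
- by move=> n i; have [+ _ _] := ab (f n).1; exact.
- move=> x [k _ Akx]; have [_ + _] := ab k.
  move=> /(_ x Akx)[l _ xl]; have [n _ fn] := fsurj (k, l) I.
  by exists n => //; rewrite fn.
- move=> K; apply: (sum_nat_inj_le (v := fun i j => box_vol (a i j) (b i j)) finj _ _ es).
  + move=> i j; apply: prodr_ge0 => l _; rewrite subr_ge0.
    by have [+ _ _] := ab i; exact.
  + by move=> i K'; have [_ _] := ab i; exact.
Qed.

Hypothesis N_gt0 : (0 < N)%N.

Lemma box_vol_diag (v : N.-tuple R) : box_vol v v = 0.
Proof.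
by rewrite /box_vol (bigD1 (Ordinal N_gt0)) //= subrr mul0r.
Qed.

Lemma covers_box (a b : N.-tuple R) : (forall i, tnth a i <= tnth b i) ->
  covers (box a b) (box_vol a b).
Proof.
move=> ab; exists (fun=> a), (fun k => if k is 0%N then b else a); split.
- by move=> [|k] i.
- by move=> x abx; exists 0%N.
- move=> [|K]; first by rewrite big_nil prodr_ge0 // => i _; rewrite subr_ge0.
  rewrite big_nat_recl //= big1 ?addr0 // => k _; exact: box_vol_diag.
Qed.

Lemma covers0 : covers set0 0.
Proof.
exists (fun=> [tuple 0 | i < N]), (fun=> [tuple 0 | i < N]); split => //.
by move=> K; rewrite big1 // => k _; exact: box_vol_diag.
Qed.

Lemma covers_ge0 A e : covers A e -> 0 <= e.
Proof. by move=> [a [b [_ _ /(_ 0%N)]]]; rewrite big_nil. Qed.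

Lemma coversU A B e e' : covers A e -> covers B e' -> covers (A `|` B) (e + e').
Proof.
move=> cA cB; have e0 := covers_ge0 cA; have e'0 := covers_ge0 cB.
rewrite -bigcup2E; apply: (@covers_bigcup _ (fun k => nth 0 [:: e; e'] k)).
  by move=> [|[|k]] //=; rewrite nth_nil; exact: covers0.
move=> [|[|K]]; rewrite ?big_nil ?big_nat1 ?addr_ge0 ?lerDl //.
rewrite 2?big_nat_recl //= big1 ?addr0 // => k _; exact: nth_nil.
Qed.

Lemma covers_bigsetU (I : Type) (r : seq I) (P : pred I)
    (A : I -> set (N.-tuple R)) (e : I -> R) :
  (forall i, P i -> covers (A i) (e i)) ->
  covers (\big[setU/set0]_(i <- r | P i) A i) (\sum_(i <- r | P i) e i).
Proof.
move=> cA; elim/big_rec2: _ => [|i A' e' Pi cA']; first exact: covers0.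
by apply: coversU => //; exact: cA.
Qed.

Definition dot c v : R := \sum_i c 0 i * tnth v i.

Lemma cell_exists (p h x : R) (K : nat) : 0 < h ->
  p <= x <= p + h * K.+1%:R ->
  exists k : 'I_K.+1, p + h * k%:R <= x <= p + h * k%:R + h.
Proof.
move=> h0 /andP[px xp]; set y := (x - p) / h.
have y0 : 0 <= y by rewrite divr_ge0 ?subr_ge0 // ltW.
have -> : x = p + h * y by rewrite /y; field; rewrite gt_eqF.
have yK : y <= K.+1%:R by rewrite ler_pdivrMr // mulrC lerBlDl.
have [k [ky yk]] : exists k : 'I_K.+1, k%:R <= y /\ y <= k.+1%:R.
  have /andP[ty yt] := truncn_itv y0.
  have [tK|Kt] := ltnP (Num.truncn y) K.+1.
    by exists (Ordinal tK); split => //; exact: ltW.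
  exists ord_max; split => //=; apply: le_trans ty.
  by rewrite ler_nat ltnW.
exists k; have -> : p + h * k%:R + h = p + h * k.+1%:R by rewrite -natr1; ring.
by rewrite !lerD2l !ler_pM2l // ky.
Qed.

(* Cut the cube into columns along the j-th axis, the cross-sections being cubes
   of side h <= r - l: in each column the strip is contained in a box of height
   O(r - l), so the total volume is O(r - l). *)
Lemma covers_strip c (j : 'I_N) (M : R) : c 0 j != 0 -> 0 < M ->
  exists2 C : R, 0 < C & forall l r : R, l < r ->
    covers [set v | (forall i, - M <= tnth v i <= M) /\ l <= dot c v <= r]
           (C * (r - l)).
Proof.
move=> cj M0; pose D := \sum_i `|c 0 i|.
have D0 : 0 <= D by exact: sumr_ge0.
exists ((2 * M) ^+ N.-1 * ((1 + 2 * D) / `|c 0 j|)) => [|l r lr].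
  have := normr_gt0 (c 0 j); rewrite cj => c0.
  by rewrite mulr_gt0 ?exprn_gt0 ?divr_gt0 //; lra.
set w := r - l; have w0 : 0 < w by rewrite subr_gt0.
have [K Kw] : exists K : nat, 2 * M / w <= K.+1%:R.
  exists (Num.truncn (2 * M / w)).
  have /truncn_itv/andP[_ /ltW//] : 0 <= 2 * M / w.
  by rewrite divr_ge0 ?mulr_ge0 // ltW.
pose h := 2 * M / K.+1%:R.
have h0 : 0 < h by rewrite divr_gt0 ?mulr_gt0.
have hK : h * K.+1%:R = 2 * M by rewrite divfK // pnatr_eq0.
have hw : h <= w.
  by rewrite ler_pdivrMr // -ler_pdivrMl // mulrC.
pose p (g : {ffun 'I_N -> 'I_K.+1}) i := - M + h * (g i)%:R.
pose q g := \sum_(i | i != j) c 0 i * p g i.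
pose z g := ((l + r) / 2 - q g) / c 0 j.
pose H := (w / 2 + D * h) / `|c 0 j|.
have H0 : 0 <= H by rewrite divr_ge0 ?addr_ge0 ?mulr_ge0 ?divr_ge0 // ltW.
pose a g := [tuple if i == j then z g - H else p g i | i < N].
pose b g := [tuple if i == j then z g + H else p g i + h | i < N].
pose G := pffun_on (@ord0 K) (predC1 j) (pred_of_simpl (@predT 'I_K.+1)).
have ab g i : tnth (a g) i <= tnth (b g) i.
  by rewrite !tnth_mktuple; case: ifP => _; lra.
have volE g : box_vol (a g) (b g) = 2 * H * h ^+ N.-1.
  rewrite /box_vol (bigD1 j) //= !tnth_mktuple eqxx; congr (_ * _); first lra.
  rewrite (eq_bigr (fun=> h)); last first.
    by move=> i ij; rewrite !tnth_mktuple (negbTE ij); lra.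
  by rewrite prodr_const cardC1 card_ord.
apply: (@covers_sub _ (\big[setU/set0]_(g in G) box (a g) (b g))
  (\sum_(g in G) box_vol (a g) (b g))); last first.
- by apply: covers_bigsetU => g _; apply: covers_box.
- rewrite (eq_bigr (fun=> 2 * H * h ^+ N.-1)) // sumr_const.
  rewrite card_pffun_on cardC1 !card_ord.
  rewrite -[leLHS]mulr_natr natrX -mulrA -exprMn hK mulrC -mulrA.
  rewrite ler_pM2l ?exprn_gt0 ?mulr_gt0 //.
  rewrite /H (mulrA 2) [leRHS]mulrAC ler_pM2r ?invr_gt0 ?normr_gt0 //.
  by have := ler_wpM2l D0 hw; lra.
- move=> v [vM /andP[lv vr]].
  have /choice[k kv] : forall i, exists k : 'I_K.+1,
      - M + h * k%:R <= tnth v i <= - M + h * k%:R + h.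
    by move=> i; apply: cell_exists => //; rewrite hK; have /andP[] := vM i; lra.
  pose g := [ffun i => if i == j then ord0 else k i] : {ffun 'I_N -> 'I_K.+1}.
  have gG : g \in G.
    apply/pffun_onP; split => //.
    by apply/fintype.subsetP => i; rewrite !inE ffunE; case: ifP.
  rewrite (bigD1 g) //=; left => i; rewrite !tnth_mktuple.
  have gk u : u != j -> p g u <= tnth v u <= p g u + h.
    by move=> uj; rewrite /p ffunE (negbTE uj); exact: kv.
  case: eqP => [->|/eqP/gk//].
  have cjv : c 0 j * tnth v j = dot c v - \sum_(i | i != j) c 0 i * tnth v i.
    by rewrite /dot (bigD1 j) //=; ring.
  have dq : `|\sum_(i | i != j) c 0 i * tnth v i - q g| <= D * h.
    rewrite /q -sumrB; apply: le_trans (ler_norm_sum _ _ _) _.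
    rewrite /D mulr_suml [leRHS](bigD1 j) //=.
    apply: ler_wpDl; first by rewrite mulr_ge0 // ltW.
    apply: ler_sum => y /gk /andP[py yp]; rewrite -mulrBr normrM ler_wpM2l //.
    by rewrite ger0_norm; lra.
  rewrite -ler_distlC /z /H.
  have -> : ((l + r) / 2 - q g) / c 0 j - tnth v j =
      ((l + r) / 2 - q g - c 0 j * tnth v j) / c 0 j by field.
  rewrite normrM normfV ler_pM2r ?invr_gt0 ?normr_gt0 // cjv.
  set u := \sum_(i | i != j) _ in dq *.
  have -> : (l + r) / 2 - q g - (dot c v - u) = (u - q g) + ((l + r) / 2 - dot c v).
    by ring.
  apply: le_trans (ler_normD _ _) _; rewrite [leRHS]addrC; apply: lerD => //.
  by rewrite ler_norml /w; lra.
Qed.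

Lemma ocitv_cover (B : set R) (e : R) : lebesgue_measure B = 0%E -> 0 < e ->
  exists l r : nat -> R, [/\ forall k, l k < r k,
    B `<=` \bigcup_k `[l k, r k]%classic
    & forall K, \sum_(0 <= k < K) (r k - l k) <= e].
Proof.
move=> B0 e0.
have e20 : 0 < e / 2 by rewrite divr_gt0.
have : (lebesgue_measure B < (e / 2)%:E)%E by rewrite B0 lte_fin.
move=> /ereal_inf_lt[z [/= F [mF BF] <-] Fe].
pose dl k := e / 2 / 2 ^+ k.+1; have dl0 k : 0 < dl k by rewrite divr_gt0 ?exprn_gt0.
have /choice[p /all_and3[lr Flr lrE]] : forall k, exists p : R * R,
    [/\ p.1 < p.2, F k `<=` `[p.1, p.2]%classic
      & (p.2 - p.1)%:E = (wlength idfun (F k) + (dl k)%:E)%E].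
  move=> k; have /ocitvP[->|[[a b] /= ab ->]] := mF k.
    by exists (0, dl k); split => //=; rewrite wlength0 add0e subr0.
  exists (a, b + dl k); split => /=.
  - by rewrite ltr_pwDr // ltW.
  - move=> y /=; rewrite !in_itv /= => /andP[/ltW -> /=] /le_trans; apply.
    by rewrite lerDl ltW.
  - by rewrite wlength_itv_bnd ?ltW // -EFinD addrAC.
exists (fun k => (p k).1), (fun k => (p k).2); split => // [y /BF [k _ Fy]|K].
  by exists k => //; exact: Flr.
rewrite -lee_fin -sumEFin (eq_bigr _ (fun k _ => lrE k)) big_split /=.
have -> : e%:E = ((e / 2)%:E + (e / 2)%:E)%E by rewrite -EFinD -splitr.
apply: leeD; last by rewrite sumEFin lee_fin sum_geometric_le // ltW.
apply: le_trans (ltW Fe); apply: nneseries_lim_ge => k _ _; exact: wlength_ge0.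
Qed.

Lemma covers_dot_preimage c (B : set R) : c != 0 -> lebesgue_measure B = 0%E ->
  lebesgue_null [set v | B (dot c v)].
Proof.
move=> c0 B0; apply: covers_null => e e0.
have [j cj] : exists j, c 0 j != 0.
  apply/existsP; apply: contraNT c0; rewrite negb_exists => /forallP c0.
  apply/eqP/rowP => i; rewrite mxE; exact/eqP/negPn/c0.
pose A (M : nat) := [set v | (forall i, - M.+1%:R <= tnth v i <= M.+1%:R) /\ B (dot c v)].
apply: (@covers_sub _ (\bigcup_M A M) e) => //.
  move=> v Bv; pose S := \sum_i `|tnth v i|.
  exists (Num.truncn S) => //; split => // i; rewrite -ler_norml.
  have /truncn_itv/andP[_ /ltW] : 0 <= S by exact: sumr_ge0.
  apply: le_trans; rewrite /S (bigD1 i) //= lerDl; exact: sumr_ge0.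
apply: (@covers_bigcup A (fun M => e / 2 ^+ M.+1)); last first.
  by move=> K; apply: sum_geometric_le; exact: ltW.
move=> M; set eM := e / _; have eM0 : 0 < eM by rewrite divr_gt0 ?exprn_gt0.
have [C C0 strip] := @covers_strip c j M.+1%:R cj (ltr0Sn _ _).
have [l [r [lr Blr rlK]]] := ocitv_cover B0 (divr_gt0 eM0 C0).
apply: (@covers_sub _ (\bigcup_k
  [set v | (forall i, - M.+1%:R <= tnth v i <= M.+1%:R) /\ l k <= dot c v <= r k]) eM) => //.
  by move=> v [vM /Blr[k _ /=]]; rewrite in_itv /= => lvr; exists k.
apply: covers_bigcup; first by move=> k; exact: strip (lr k).
move=> K; rewrite -mulr_sumr; apply: le_trans (ler_wpM2l (ltW C0) (rlK K)) _.
by rewrite mulrC divfK // gt_eqF.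
Qed.

End Covers.

(** * The Riemann-Lebesgue lemma *)

Import HBSimple.

Section RiemannLebesgue.
Context {R : realType}.
Variable phi : R.
Notation mu := (@lebesgue_measure R).
Notation RT := (measurableTypeR R).
Implicit Types (E A : set RT) (f g : RT -> R).

Lemma continuous_cos_affine (t : R) : continuous (fun s : R => cos (t * s + phi)).
Proof.
move=> s; apply: (@continuous_comp _ _ _ (fun s => t * s + phi) (@cos R)); last first.
  exact: continuous_cos.
by apply: cvgD; [apply: cvgM; [exact: cvg_cst|exact: cvg_id]|exact: cvg_cst].
Qed.

Lemma measurable_cos_affine (t : R) E : measurable E ->
  measurable_fun E (fun s : RT => cos (t * s + phi)).
Proof.
move=> mE; apply: measurable_funTS; apply: continuous_measurable_fun.
exact: continuous_cos_affine.
Qed.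

Lemma integrableM_cos (t : R) E f : measurable E -> mu.-integrable E (EFin \o f) ->
  mu.-integrable E (EFin \o (fun s => f s * cos (t * s + phi))).
Proof.
move=> mE fi; apply: (le_integrable mE _ _ fi).
  apply/measurable_EFinP; apply: measurable_funM; last exact: measurable_cos_affine.
  by case/integrableP : fi => /measurable_EFinP.
by move=> s _ /=; rewrite lee_fin normrM ler_piMr // cos_max.
Qed.

Definition osc_vanish E f : Prop :=
  \int[mu]_(s in E) (f s * cos (t * s + phi)) @[t --> +oo] --> (0 : R).

Lemma osc_vanish_L1_lim E f (g : nat -> RT -> R) : measurable E ->
  mu.-integrable E (EFin \o f) -> (forall n, mu.-integrable E (EFin \o g n)) ->
  (forall n, osc_vanish E (g n)) ->
  (fun n => \int[mu]_(s in E) `|(f s)%:E - (g n s)%:E|)%E @ \oo --> 0%E ->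
  osc_vanish E f.
Proof.
move=> mE fi gi gv fg; apply/cvgr0Pnorm_le => e e0.
have e2 : 0 < e / 2 by rewrite divr_gt0.
have dfi n : mu.-integrable E (EFin \o (fun s => f s - g n s)).
  by rewrite (_ : _ \o _ = (EFin \o f) \- (EFin \o g n))%E //; exact: integrableB.
have [n fgn] : exists n, \int[mu]_(s in E) `|f s - g n s| <= e / 2.
  move/fine_fcvg/cvgr0Pnorm_le/(_ _ e2) : fg => [n _ /(_ n (leqnn n))] /=.
  by move=> /(le_trans (ler_norm _)); exists n.
near=> t.
have -> : \int[mu]_(s in E) (f s * cos (t * s + phi)) =
    \int[mu]_(s in E) ((f s - g n s) * cos (t * s + phi)) +
    \int[mu]_(s in E) (g n s * cos (t * s + phi)).
  rewrite -RintegralD //; [|exact: integrableM_cos..].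
  by apply: eq_Rintegral => s _; rewrite -mulrDl subrK.
rewrite (splitr e); apply: le_trans (ler_normD _ _) _; apply: lerD; last first.
  by near: t; move/cvgr0Pnorm_le : (gv n); apply.
apply: le_trans (le_normr_Rintegral mE (integrableM_cos _ mE (dfi n))) _.
apply: le_trans fgn; apply: le_Rintegral => //.
- exact: (integrable_norm (integrableM_cos t mE (dfi n))).
- exact: (integrable_norm (dfi n)).
- by move=> s _ /=; rewrite normrM ler_piMr // cos_max.
Unshelve. all: by end_near. Qed.

Lemma osc_vanish_dominated E f (g : nat -> RT -> R) h : measurable E ->
  mu.-integrable E (EFin \o f) -> (forall n, mu.-integrable E (EFin \o g n)) ->
  mu.-integrable E (EFin \o h) ->
  (forall n s, E s -> `|g n s| <= h s) ->
  (forall s, E s -> g n s @[n --> \oo] --> f s) ->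
  (forall n, osc_vanish E (g n)) -> osc_vanish E f.
Proof.
move=> mE fi gi hi gh gf gv; apply: (osc_vanish_L1_lim mE fi gi gv).
have := dominated_convergence mE (fun n => measurable_int _ (gi n))
  (measurable_int _ fi) _ hi _.
case=> [||_ + _]; first by apply: aeW => s Es; apply: cvg_EFin; [exact: nearW|exact: gf].
  by apply: aeW => s n Es; rewrite lee_fin; exact: gh.
apply: cvg_trans; apply: near_eq_cvg; apply: nearW => n /=.
by apply: eq_integral => s _ /=; rewrite distrC.
Qed.

Lemma norm_Rintegral_cos_le (a b t : R) : t != 0 ->
  `|\int[mu]_(s in `[a, b]) cos (t * s + phi)| <= 2 / `|t|.
Proof.
move=> t0.
have [ab|ba] := ltP a b; last first.
  have -> : \int[mu]_(s in `[a, b]) cos (t * s + phi) = 0.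
    move: ba; rewrite le_eqVlt => /predU1P[->|ba].
      by rewrite set_itv1 Rintegral_set1.
    by rewrite set_itv_ge ?Rintegral_set0 // bnd_simp -ltNge.
  by rewrite normr0 divr_ge0.
pose F s := t^-1 * sin (t * s + phi).
have dF (s : R) : is_derive s 1 F (cos (t * s + phi)).
  have dl : is_derive s 1 (fun u => t * u + phi) (t *: 1 + 0).
    exact: is_deriveD.
  have := @is_derive1_comp R (@sin R) _ s _ _ (is_derive_sin _) dl.
  move=> /(@is_deriveZ _ _ _ _ t^-1) dF.
  by apply: (is_derive_eq dF); rewrite /GRing.scale /= mulr1 addr0 mulrC mulfK.
have cF : continuous F.
  move=> s; apply: differentiable_continuous; apply/derivable1_diffP.
  exact: (@ex_derive _ _ _ _ _ _ _ (dF s)).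
rewrite /Rintegral (@continuous_FTC2 _ _ F) //; last 3 first.
- apply: continuous_subspaceT; exact: continuous_cos_affine.
- split=> [s _| |]; first exact: (@ex_derive _ _ _ _ _ _ _ (dF s)).
  + exact: cvg_at_right_filter (cF a).
  + exact: cvg_at_left_filter (cF b).
- by move=> s _; rewrite derive1E; exact: (@derive_val _ _ _ _ _ _ _ (dF s)).
rewrite -EFinB /= /F -mulrBr normrM normfV mulrC ler_pM2r ?invr_gt0 ?normr_gt0 //.
apply: le_trans (ler_normB _ _) _.
by have := sin_max (t * b + phi); have := sin_max (t * a + phi); lra.
Qed.

Lemma osc_vanish_itv (a b : R) : osc_vanish `[a, b] (cst 1).
Proof.
apply/cvgr0Pnorm_le => e e0; near=> t.
have t0 : 0 < t by near: t; exact: nbhs_pinfty_gt.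
under eq_Rintegral do rewrite mul1r.
apply: le_trans (norm_Rintegral_cos_le a b (lt0r_neq0 t0)) _.
by rewrite gtr0_norm // ler_pdivrMr // mulrC -ler_pdivrMr.
Unshelve. all: by end_near. Qed.

Lemma osc_vanish_sum (I : Type) (r : seq I) (c : I -> R) (g : I -> RT -> R) E :
  measurable E -> (forall i, mu.-integrable E (EFin \o g i)) ->
  (forall i, osc_vanish E (g i)) ->
  osc_vanish E (fun s => \sum_(i <- r) c i * g i s).
Proof.
move=> mE gi gv; rewrite /osc_vanish.
have -> : nbhs (0 : R) = nbhs (\sum_(i <- r) c i * 0).
  by rewrite big1 // => i _; rewrite mulr0.
apply: cvg_trans (@cvg_lin_comb _ _ _ _ _ r c _ _ gv); apply: near_eq_cvg; apply: nearW => t.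
rewrite -Rintegral_lin_comb //; last by move=> i; exact: integrableM_cos.
by apply: eq_Rintegral => s _; rewrite mulr_suml; apply: eq_bigr => i _; rewrite mulrA.
Qed.

Lemma integrable_indic_itv (a b : R) A : measurable A ->
  mu.-integrable `[a, b] (EFin \o (\1_A : RT -> R)).
Proof.
move=> mA; apply: measurable_bounded_integrable => //.
- by rewrite /= lebesgue_measure_itv /=; case: ifP => _; rewrite ?ltry ?ltey.
- exists 1; split => // M M1 s _; apply: le_trans (ltW M1).
  by rewrite indicE; case: (_ \in _); rewrite ?normr1 ?normr0.
Qed.

Lemma osc_vanish_indic (a b : R) A : measurable A -> osc_vanish `[a, b] \1_A.
Proof.
move=> mA.
have I1 : mu.-integrable `[a, b] (EFin \o (\1_setT : RT -> R)).
  exact: integrable_indic_itv.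
have V1 : osc_vanish `[a, b] (\1_setT : RT -> R).
  by have := osc_vanish_itv a b; rewrite indicT.
pose P A := osc_vanish `[a, b] (\1_A : RT -> R).
suff : P A by [].
have mE : @measurable _ RT = <<s @RGenCInfty.G R >> by exact: RGenCInfty.measurableE.
apply: (dynkin_induction mE); rewrite /P //; last by rewrite -mE.
- move=> _ _ [x ->] [y ->]; exists (Num.max x y).
  by apply/seteqP; split => z /=; rewrite !in_itv /= !andbT ge_max => /andP.
- move=> _ [x ->].
  apply: cvg_trans (osc_vanish_itv (Num.max x a) b); apply: near_eq_cvg.
  apply: nearW => t.
    have -> : `[Num.max x a, b]%classic = `[a, b]%classic `&` `[x, +oo[%classic :> set RT.
      apply/seteqP; split => z /=; rewrite !in_itv /= ge_max andbT.
        by move=> /andP[/andP[-> ->] ->].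
      by move=> [/andP[-> ->] ->].
    rewrite Rintegral_mkcondr; apply: eq_Rintegral => s _.
  by rewrite patchE indicE; case: (_ \in _); rewrite ?mul0r.
- move=> S mS VS.
  have := @osc_vanish_sum bool [:: true; false] (fun b => if b then 1 else -1)
    (fun b => if b then \1_setT : RT -> R else \1_S) `[a, b].
  rewrite /osc_vanish => H.
  have -> : (\1_(~` S) : RT -> R) = (fun s => \sum_(i <- [:: true; false])
     (if i then 1 else -1) * (if i then \1_setT : RT -> R else \1_S) s).
    apply/funext => s; rewrite !big_cons big_nil /= !indicE in_setT in_setC.
    by case: (s \in S); rewrite /= ?mulr1 ?mulr0 ?addr0 ?subrr.
  by apply: H => // -[]//; exact: integrable_indic_itv.
- move=> F mF tF VF.
  pose g n : RT -> R := \1_(\bigcup_(k in [set k | (k < n)%N]) F k).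
  apply: (@osc_vanish_dominated _ _ g (\1_setT : RT -> R)) => //.
  + apply: integrable_indic_itv; exact: bigcup_measurable.
  + move=> n; apply: integrable_indic_itv; exact: bigcup_measurable.
  + move=> n s _; rewrite /g !indicE in_setT.
    by case: (_ \in _); rewrite ?normr1 ?normr0.
  + move=> s _; have [[k _ Fks]|nFs] := pselect ((\bigcup_k F k) s).
      apply: cvg_near_cst; exists k.+1 => // n /= kn.
      rewrite /g !indicE !mem_set //; first by exists k.
      by exists k.
    apply: cvg_near_cst; apply: nearW => n; rewrite /g !indicE !memNset //.
    by move=> [k _ Fks]; apply: nFs; exists k.
  + move=> n; have -> : g n = (fun s => \sum_(k <- iota 0 n) 1 * \1_(F k) s).
      apply/funext => s; rewrite /g indicE.
      have [[k /= kn Fks]|nFs] := pselect ((\bigcup_(k in [set k | (k < n)%N]) F k) s).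
        rewrite mem_set; last by exists k.
        rewrite (bigD1_seq k) ?iota_uniq ?mem_iota //= indicE mem_set // mulr1.
        rewrite big1 ?addr0 // => l /eqP lk; rewrite indicE memNset ?mulr0 // => Fls.
        by apply: lk; apply: tF => //; exists s.
      rewrite memNset // big_seq big1 // => k; rewrite mem_iota add0n => kn.
      by rewrite indicE memNset ?mulr0 // => Fks; apply: nFs; exists k.
    apply: osc_vanish_sum => // k; exact: integrable_indic_itv.
Qed.

Lemma osc_vanish_segment (a b : R) f : mu.-integrable `[a, b] (EFin \o f) ->
  osc_vanish `[a, b] f.
Proof.
move=> fi; have mI : measurable (`[a, b] : set RT) by [].
have [g [gi _ gf]] := approximation_sfun_integrable mI fi.
apply: (osc_vanish_L1_lim mI fi gi _ gf) => // n.
rewrite (_ : (g n : RT -> R) = (fun s =>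
  \sum_(y <- finmap.enum_fset (fset_set (range (g n)))) y * \1_(g n @^-1` [set y]) s)).
  apply: osc_vanish_sum => // y; first exact: integrable_indic_itv.
  exact: osc_vanish_indic.
by apply/funext => s; rewrite fimfunE fsbig_finite.
Qed.

Lemma osc_vanish_integrable f : mu.-integrable setT (EFin \o f) ->
  osc_vanish setT f.
Proof.
move=> fi.
pose g (n : nat) : RT -> R := f \_ `[- n%:R, n%:R].
apply: (@osc_vanish_dominated _ _ g (fun s => `|f s|)) => //.
- move=> n; rewrite (_ : _ \o _ = ((EFin \o f) \_ (`[- n%:R, n%:R] : set RT))%R).
    by apply/integrable_restrict => //; rewrite setTI; exact: integrableS fi.
  by rewrite restrict_EFin.
- exact: integrable_norm.
- by move=> n s _; rewrite /g patchE; case: ifP => // _; rewrite normr0.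
- move=> s _; apply: cvg_near_cst; near=> n.
  rewrite /g patchE mem_set //= in_itv /= -ler_norml; near: n.
  exact: nbhs_infty_ger.
- move=> n; rewrite /osc_vanish.
  have : osc_vanish `[- n%:R, n%:R] f.
    by apply: osc_vanish_segment; exact: integrableS fi.
  apply: cvg_trans; apply: near_eq_cvg; apply: nearW => t.
  rewrite [LHS]Rintegral_mkcond; apply: eq_Rintegral => s _.
  by rewrite /g !patchE; case: ifP => // _; rewrite mul0r.
Unshelve. all: by end_near. Qed.

End RiemannLebesgue.

Lemma integrable_bounded_by {d} {T : measurableType d} {R : realType}
    (P : {finite_measure set T -> \bar R}) (f : T -> R) (M : R) :
  measurable_fun setT f -> (forall x, `|f x| <= M) ->
  P.-integrable setT (EFin \o f).
Proof.
move=> mf fM; apply: measurable_bounded_integrable => //.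
- by have /fin_num_fun_lty := fin_num_measure P; exact.
- by exists M; split => [|K MK x _]; [exact: num_real|exact: le_trans (fM x) (ltW MK)].
Qed.

Lemma charfun_vanish {d} {Omega : measurableType d} {R : realType}
    (P : probability Omega R) (S : Omega -> R) (phi : R) :
  measurable_fun setT S ->
  (forall B : set R, measurable B -> lebesgue_measure B = 0%E -> P (S @^-1` B) = 0%E) ->
  \int[P]_w cos (t * S w + phi) @[t --> +oo] --> (0 : R).
Proof.
move=> mS acS.
have mS' : @measurable_fun _ _ Omega (measurableTypeR R) setT S by exact: mS.
pose X : {mfun Omega >-> measurableTypeR R} :=
  @mfun_Sub _ _ Omega (measurableTypeR R) S (mem_set mS').
pose nu := distribution P X.
have numu : nu `<< @lebesgue_measure R.
  by apply/null_content_dominatesP => B mB B0; exact: acS.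
pose f := Radon_Nikodym (charge_of_finite_measure nu) (@lebesgue_measure R).
have fi : (@lebesgue_measure R).-integrable setT f.
  exact: Radon_Nikodym_integrable.
have fE : EFin \o (fine \o f) = f.
  by apply/funext => s; rewrite /= fineK //; exact: Radon_Nikodym_fin_num.
have fi' : (@lebesgue_measure R).-integrable setT (EFin \o (fine \o f)).
  by rewrite fE.
have := osc_vanish_integrable phi fi'.
apply: cvg_trans; apply: near_eq_cvg; apply: nearW => t.
rewrite /Rintegral; congr fine.
pose g (s : measurableTypeR R) := (cos (t * s + phi))%:E.
have mg : measurable_fun setT g.
  by apply/measurable_EFinP; exact: measurable_cos_affine.
transitivity (\int[nu]_s g s)%E.
  rewrite -(@Radon_Nikodym_change_of_variables _ _ _ nu _ numu) //.
    apply: eq_integral => s _.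
    by rewrite -/f EFinM muleC -[in RHS]fE.
  apply: (@integrable_bounded_by _ _ _ nu _ 1).
    exact: measurable_cos_affine.
  by move=> s; exact: cos_max.
rewrite integral_distribution //.
apply: (@integrable_bounded_by _ _ _ P (fun w => cos (t * S w + phi)) 1).
  exact: (measurableT_comp (measurable_cos_affine phi t measurableT) mS).
by move=> s; exact: cos_max.
Qed.

(** * Time averages *)

Section TimeAverage.
Context {R : realType}.
Notation mu := (@lebesgue_measure R).
Implicit Types f g : R -> R.

Lemma integrable_continuous_segment f (a b : R) : continuous f ->
  mu.-integrable `[a, b] (EFin \o f).
Proof.
move=> cf; apply: continuous_compact_integrable; first exact: segment_compact.
exact: continuous_subspaceT.
Qed.

Lemma tavg_T_lin (I : Type) (r : seq I) (c : I -> R) (g : I -> R -> R) (T : R) :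
  (forall i, continuous (g i)) ->
  tavg_T (fun t => \sum_(i <- r) c i * g i t) T = \sum_(i <- r) c i * tavg_T (g i) T.
Proof.
move=> cg; rewrite /tavg_T Rintegral_lin_comb //.
  by rewrite mulr_sumr; apply: eq_bigr => i _; rewrite mulrCA.
by move=> i; exact: integrable_continuous_segment.
Qed.

Lemma tavg_T_cst (l T : R) : 0 < T -> tavg_T (cst l) T = l.
Proof.
move=> T0; rewrite /tavg_T Rintegral_cst //= lebesgue_measure_itv /= lte_fin T0.
by rewrite -EFinB /= subr0 mulrCA mulVf ?mulr1 // gt_eqF.
Qed.

Lemma tavg_T_cesaro f (l : R) : continuous f -> f t @[t --> +oo] --> l ->
  tavg_T f T @[T --> +oo] --> l.
Proof.
move=> cf fl; pose g t := f t - l.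
have cg : continuous g by move=> t; apply: cvgB (cf t) _; exact: cvg_cst.
apply/cvgrPdist_le => e e0.
have e2 : 0 < e / 2 by rewrite divr_gt0.
have : \forall t \near +oo, `|g t| <= e / 2.
  by move/cvgrPdist_le : fl => /(_ _ e2); apply: filterS => t; rewrite distrC.
move=> [T0' [_ gT0']]; pose T0 := Num.max T0' 0 + 1.
have T00 : 0 < T0 by apply: ltr_wpDl => //; rewrite le_max lexx orbT.
have gT0 t : T0 <= t -> `|g t| <= e / 2.
  move=> T0t; apply: gT0'; apply: lt_le_trans T0t.
  by apply: ltr_pwDr => //; rewrite le_max lexx.
pose C := `|\int[mu]_(t in `[0, T0]) g t|.
near=> T.
have T0T : T0 < T by near: T; apply: nbhs_pinfty_gt; exact: num_real.
have TC : C / (e / 2) <= T by near: T; apply: nbhs_pinfty_ge; exact: num_real.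
have Tp : 0 < T by exact: lt_trans T0T.
have -> : l - tavg_T f T = - (T^-1 * \int[mu]_(t in `[0, T]) g t).
  have -> : l = tavg_T (cst l) T by rewrite tavg_T_cst.
  rewrite /tavg_T -mulrBr -mulrN; congr (_ * _).
  rewrite RintegralB //; [|exact: integrable_continuous_segment|].
    by rewrite opprB.
  by apply: integrable_continuous_segment => t; exact: cvg_cst.
rewrite normrN normrM gtr0_norm ?invr_gt0 // mulrC ler_pdivrMr //.
have gi := @integrable_continuous_segment g 0 T cg.
have -> : \int[mu]_(t in `[0, T]) g t =
    \int[mu]_(t in `[0, T0]) g t + \int[mu]_(t in `]T0, T]) g t.
  by rewrite -(@Rintegral_itvB _ g (BLeft 0) (BRight T) T0) ?bnd_simp ?ltW //; lra.
apply: le_trans (ler_normD _ _) _.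
have -> : e * T = e / 2 * T + e / 2 * T by lra.
apply: lerD; first by rewrite mulrC -ler_pdivrMr.
have gi' : mu.-integrable `]T0, T] (EFin \o g).
  apply: integrableS gi => //; apply: subset_itvr; rewrite bnd_simp.
  exact: ltW.
apply: le_trans (le_normr_Rintegral _ gi') _ => //.
apply: (@le_trans _ _ (\int[mu]_(t in `]T0, T]) (e / 2))).
  apply: le_Rintegral => //; first exact: integrable_norm.
    have ci : mu.-integrable `[T0, T] (EFin \o cst (e / 2)).
      by apply: integrable_continuous_segment => t; exact: cvg_cst.
    by apply: integrableS ci => //; apply: subset_itvr; rewrite bnd_simp.
  by move=> t /=; rewrite in_itv /= => /andP[/ltW /gT0].
rewrite Rintegral_cst //= lebesgue_measure_itv /= lte_fin T0T -EFinB /=.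
by rewrite ler_pM2l // gerBl ltW.
Unshelve. all: by end_near. Qed.

Lemma tavg_T_cos (a phi : R) :
  tavg_T (fun t => cos (t * a + phi)) T @[T --> +oo] --> cos phi * \1_[set 0] a.
Proof.
rewrite indicE; have [->|a0] := eqVneq a 0.
  rewrite mem_set // mulr1.
  have -> : (fun t : R => cos (t * 0 + phi)) = cst (cos phi).
    by apply/funext => t; rewrite mulr0 add0r.
  apply: cvg_near_cst; near=> T; by rewrite tavg_T_cst.
rewrite memNset ?mulr0; last by move=> /= /eqP; rewrite (negbTE a0).
apply/cvgr0Pnorm_le => e e0; near=> T.
have T0 : 0 < T by near: T; apply: nbhs_pinfty_gt; exact: num_real.
rewrite /tavg_T normrM gtr0_norm ?invr_gt0 // mulrC ler_pdivrMr //.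
under eq_Rintegral do rewrite mulrC.
apply: le_trans (norm_Rintegral_cos_le phi 0 T a0) _.
rewrite [leRHS]mulrC -ler_pdivrMr //; near: T; apply: nbhs_pinfty_ge; exact: num_real.
Unshelve. all: by end_near. Qed.

Lemma continuous_cos_affine_time (a phi : R) :
  continuous (fun t : R => cos (t * a + phi)).
Proof.
rewrite (_ : (fun t => cos (t * a + phi)) = (fun t => cos (a * t + phi))).
  exact: continuous_cos_affine.
by apply/funext => t; rewrite mulrC.
Qed.

End TimeAverage.

(** * Trigonometric sums *)

Section TrigSums.
Context {R : realType} {N : nat}.
Implicit Types (v : N.-tuple R) (s : seq (R * R * 'rV[R]_N)).

Definition trig_eval s v (t : R) : R :=
  \sum_(p <- s) p.1.1 * cos (t * dot p.2 v + p.1.2).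

Definition trig_mean s v : R :=
  \sum_(p <- s) p.1.1 * (cos p.1.2 * \1_[set 0] (dot p.2 v)).

Definition trig_limit s : R :=
  \sum_(p <- s) p.1.1 * (cos p.1.2 * (p.2 == 0)%:R).

Definition is_trig (f : N.-tuple R -> R -> R) : Prop :=
  exists s, forall v t, f v t = trig_eval s v t.

Lemma dot0 v : dot 0 v = 0.
Proof. by rewrite /dot big1 // => i _; rewrite mxE mul0r. Qed.

Lemma dotD (a b : 'rV[R]_N) v : dot (a + b) v = dot a v + dot b v.
Proof. by rewrite -big_split; apply: eq_bigr => i _; rewrite mxE mulrDl. Qed.

Lemma dotN (a : 'rV[R]_N) v : dot (- a) v = - dot a v.
Proof. by rewrite -sumrN; apply: eq_bigr => i _; rewrite mxE mulNr. Qed.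

Lemma dot_delta (j : 'I_N) v : dot (delta_mx 0 j) v = tnth v j.
Proof.
rewrite /dot (bigD1 j) //= mxE !eqxx mul1r big1 ?addr0 // => i ij.
by rewrite mxE (negbTE ij) andbF mul0r.
Qed.

Lemma is_trig_cos (j : 'I_N) (A phi : R) :
  is_trig (fun v t => A * cos (t * tnth v j + phi)).
Proof.
exists [:: (A, phi, delta_mx 0 j)] => v t.
by rewrite /trig_eval big_seq1 /= dot_delta.
Qed.

Lemma is_trig0 : is_trig (fun _ _ => 0).
Proof. by exists [::] => v t; rewrite /trig_eval big_nil. Qed.

Lemma is_trig1 : is_trig (fun _ _ => 1).
Proof.
exists [:: (1, 0, 0)] => v t.
by rewrite /trig_eval big_seq1 /= dot0 mulr0 add0r cos0 mulr1.
Qed.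

Lemma is_trigD f g : is_trig f -> is_trig g -> is_trig (fun v t => f v t + g v t).
Proof.
move=> [s sE] [s' s'E]; exists (s ++ s') => v t.
by rewrite /trig_eval big_cat /= sE s'E.
Qed.

Lemma cosM (x y : R) : cos x * cos y = 2^-1 * cos (x + y) + 2^-1 * cos (x - y).
Proof. by rewrite cosD cosB; field. Qed.

Lemma is_trigM f g : is_trig f -> is_trig g -> is_trig (fun v t => f v t * g v t).
Proof.
move=> [s sE] [s' s'E].
exists ([seq (p.1.1 * q.1.1 / 2, p.1.2 + q.1.2, p.2 + q.2) | p <- s, q <- s'] ++
        [seq (p.1.1 * q.1.1 / 2, p.1.2 - q.1.2, p.2 - q.2) | p <- s, q <- s']) => v t.
rewrite sE s'E /trig_eval big_cat /= !big_allpairs_dep /= -big_split /= mulr_suml.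
apply: eq_bigr => p _; rewrite mulr_sumr -big_split /=; apply: eq_bigr => q _ /=.
rewrite mulrACA cosM.
rewrite !dotD dotN.
have -> : t * (dot p.2 v + dot q.2 v) + (p.1.2 + q.1.2) =
  t * dot p.2 v + p.1.2 + (t * dot q.2 v + q.1.2) by ring.
have -> : t * (dot p.2 v - dot q.2 v) + (p.1.2 - q.1.2) =
  t * dot p.2 v + p.1.2 - (t * dot q.2 v + q.1.2) by ring.
by ring.
Qed.

Lemma is_trigX f m : is_trig f -> is_trig (fun v t => f v t ^+ m).
Proof.
move=> tf; elim: m => [|m IH]; first exact: is_trig1.
have [s sE] := is_trigM tf IH; exists s => v t; rewrite -sE exprS //.
Qed.

Lemma is_trig_sum (I : Type) (r : seq I) (f : I -> N.-tuple R -> R -> R) :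
  (forall i, is_trig (f i)) -> is_trig (fun v t => \sum_(i <- r) f i v t).
Proof.
move=> tf; elim: r => [|i r IH].
  by have [s sE] := is_trig0; exists s => v t; rewrite -sE big_nil.
by have [s sE] := is_trigD (tf i) IH; exists s => v t; rewrite -sE big_cons.
Qed.

Lemma tavg_trig s v : tavg_T (trig_eval s v) T @[T --> +oo] --> trig_mean s v.
Proof.

have gl (p : R * R * 'rV[R]_N) := @tavg_T_cos R (dot p.2 v) p.1.2.
apply: cvg_trans (@cvg_lin_comb _ _ _ _ _ s (fun p => p.1.1) _ _ gl).
apply: near_eq_cvg; apply: nearW => T; rewrite -tavg_T_lin // => p.
exact: continuous_cos_affine_time.
Qed.

Lemma measurable_dot (c : 'rV[R]_N) : measurable_fun setT (dot c).
Proof.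
apply: measurable_sum => i; apply: measurable_funM => //.
exact: measurable_tnth.
Qed.

Lemma measurable_trig_mean s : measurable_fun setT (trig_mean s).
Proof.
apply: measurable_sum => p; apply: measurable_funM => //.
apply: measurable_funM => //; apply: measurableT_comp; last exact: measurable_dot.
by apply: measurable_indic; exact: measurable_set1.
Qed.

Section Law.
Context {d} {Omega : measurableType d} (P : probability Omega R).
Variable V : Omega -> N.-tuple R.
Hypothesis mV : measurable_fun setT V.
Hypothesis acV : forall A : set (N.-tuple R), measurable A -> lebesgue_null A ->
  P (V @^-1` A) = 0%E.

Lemma law_dot_ac (c : 'rV[R]_N) (B : set R) : c != 0 -> measurable B ->
  lebesgue_measure B = 0%E -> P ((fun w => dot c (V w)) @^-1` B) = 0%E.
Proof.
move=> c0 mB B0.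
have N0 : (0 < N)%N.
  rewrite lt0n; apply/eqP => N0; move/eqP: c0; apply; apply/rowP => i.
  by have := ltn_ord i; rewrite [X in (_ < X)%N]N0.
apply: (acV (A := [set v | B (dot c v)])); last exact: covers_dot_preimage.
by rewrite -[X in measurable X]setTI; exact: measurable_dot.
Qed.

Lemma measurable_dotV c : measurable_fun setT (fun w => dot c (V w)).
Proof. exact: measurableT_comp (measurable_dot c) mV. Qed.

Lemma measurable_cosV c phi (t : R) :
  measurable_fun setT (fun w => cos (t * dot c (V w) + phi)).
Proof.
exact: (measurableT_comp (measurable_cos_affine phi t measurableT) (measurable_dotV c)).
Qed.

Lemma integrable_cosV c phi (t : R) :
  P.-integrable setT (EFin \o (fun w => cos (t * dot c (V w) + phi))).
Proof.
apply: (@integrable_bounded_by _ _ _ P _ 1); first exact: measurable_cosV.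
by move=> w; exact: cos_max.
Qed.

Lemma trig_mean_ae s : {ae P, forall w, trig_mean s (V w) = trig_limit s}.
Proof.
elim: s => [|p s IH].
  by apply: aeW => w; rewrite /trig_mean /trig_limit !big_nil.
have [p0|p0] := eqVneq p.2 0.
  apply: filterS IH => w; rewrite /trig_mean /trig_limit !big_cons => ->.
  by rewrite p0 eqxx dot0 indicE mem_set.
have : {ae P, forall w, dot p.2 (V w) <> 0}.
  exists ((fun w => dot p.2 (V w)) @^-1` [set 0]); split.
  - by rewrite -[X in measurable X]setTI; apply: measurable_dotV.
  - by apply: law_dot_ac => //; exact: lebesgue_measure_set1.
  - by move=> w /contrapT.
apply: filterS2 IH => w; rewrite /trig_mean /trig_limit !big_cons => -> dp.
by rewrite (negbTE p0) indicE memNset.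
Qed.

Lemma Rintegral_trig s t : \int[P]_w trig_eval s (V w) t =
  \sum_(p <- s) p.1.1 * \int[P]_w cos (t * dot p.2 (V w) + p.1.2).
Proof.
by rewrite -Rintegral_lin_comb // => p; exact: integrable_cosV.
Qed.

Lemma cvg_Rintegral_trig s :
  \int[P]_w trig_eval s (V w) t @[t --> +oo] --> trig_limit s.
Proof.
under eq_fun do rewrite Rintegral_trig.
apply: cvg_lin_comb => p; have [p0|p0] := eqVneq p.2 0.
  under eq_fun do under eq_Rintegral do rewrite p0 dot0 mulr0 add0r.
  rewrite mulr1; apply: cvg_near_cst; apply: nearW => t.
  by rewrite Rintegral_cst //= probability_setT mulr1.
rewrite mulr0; apply: charfun_vanish; first exact: measurable_dotV.
by move=> B; exact: law_dot_ac.
Qed.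

Lemma continuous_Rintegral_cos c phi :
  continuous (fun t : R => \int[P]_w cos (t * dot c (V w) + phi)).
Proof.
move=> t; have := @continuity_under_integral R d Omega P
  (fun t w => cos (t * dot c (V w) + phi)) setT measurableT (t - 1) (t + 1)
  (fun t _ => integrable_cosV c phi t).
move=> /(_ _ (cst 1)); apply.
- by apply: aeW => w _ u _; exact: continuous_cos_affine_time.
- apply: (@integrable_bounded_by _ _ _ P (cst 1) 1) => // w.
  by rewrite normr1.
- by move=> u _; apply: aeW => w _; exact: cos_max.
- by rewrite inE /= in_itv /=; lra.
Qed.

Lemma tavg_Rintegral_trig s :
  tavg_T (fun t => \int[P]_w trig_eval s (V w) t) T @[T --> +oo] --> trig_limit s.
Proof.
apply: tavg_T_cesaro; last exact: cvg_Rintegral_trig.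
under eq_fun do rewrite Rintegral_trig.
move=> t; apply: cvg_lin_comb => p; exact: continuous_Rintegral_cos.
Qed.

Lemma integral_trig_mean s :
  (\int[P]_w (trig_mean s (V w))%:E = (trig_limit s)%:E)%E.
Proof.
transitivity (\int[P]_w (trig_limit s)%:E)%E.
  apply: ae_eq_integral => //.
  - apply/measurable_EFinP.
    exact: measurableT_comp (measurable_trig_mean s) mV.
  - by apply: filterS (trig_mean_ae s) => w + _ => ->.
by rewrite integral_cst //= probability_setT mule1.
Qed.

End Law.
End TrigSums.

Lemma cabs_pow_even {R : realType} (z : complex R) (m : nat) :
  cabs_pow z (2 * m) = (complex.Re z ^+ 2 + complex.Im z ^+ 2) ^+ m.
Proof.
have zE : `|z| ^+ (2 * m) = ((complex.Re z ^+ 2 + complex.Im z ^+ 2) ^+ m)%:C%C.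
  rewrite exprM rmorphXn /=; congr (_ ^+ m).
  rewrite normc_def -rmorphXn /= sqr_sqrtr ?addr_ge0 ?sqr_ge0 //.
exact: (congr1 (@complex.Re R) zE).
Qed.

Lemma is_trig_cabs_pow {R : realType} {N : nat} (dd : 'I_N -> complex R) (m : nat) :
  is_trig (fun (v : N.-tuple R) t =>
    cabs_pow (\sum_j expi (- (t * tnth v j)) * dd j) (2 * m)).
Proof.
pose u (v : N.-tuple R) (t : R) :=
  \sum_j (complex.Re (dd j) * cos (t * tnth v j + 0) +
          complex.Im (dd j) * cos (t * tnth v j + (- (pi / 2)))).
pose u' (v : N.-tuple R) (t : R) :=
  \sum_j (complex.Im (dd j) * cos (t * tnth v j + 0) +
          - complex.Re (dd j) * cos (t * tnth v j + (- (pi / 2)))).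
have tu : is_trig u.
  by apply: is_trig_sum => j; apply: is_trigD; exact: is_trig_cos.
have tu' : is_trig u'.
  by apply: is_trig_sum => j; apply: is_trigD; exact: is_trig_cos.
have [s sE] := is_trigX m (is_trigD (is_trigM tu tu) (is_trigM tu' tu')).
exists s => v t; rewrite -sE cabs_pow_even; congr ((_ + _) ^+ m).
  rewrite -expr2; congr (_ ^+ 2); rewrite raddf_sum; apply: eq_bigr => j _ /=.
  rewrite /expi; case: (dd j) => a b /=.
  by rewrite addr0 cosBpihalf cosN sinN; ring.
rewrite -expr2; congr (_ ^+ 2); rewrite raddf_sum; apply: eq_bigr => j _ /=.
rewrite /expi; case: (dd j) => a b /=.
  by rewrite addr0 cosBpihalf cosN sinN; ring.
Qed.

Lemma chi_expand {R : realType} (n N : nat) (rho : 'M[complex R]_n)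
    (E : 'I_N -> R) (Pi : 'I_N -> 'M[complex R]_n) (t : R) :
  chi rho E Pi t = \sum_j expi (- (t * E j)) * \tr (rho *m Pi j).
Proof.
rewrite /chi /evol mulmx_sumr raddf_sum; apply: eq_bigr => j _ /=.
by rewrite -scalemxAr mxtraceZ.
Qed.

Theorem theorem1 (R : realType) (d : measure_display) (Omega : measurableType d)
  (P : probability Omega R) (X : Type) (x : Omega -> X)
  (n NB : nat) (H : X -> 'M[complex R]_n) (E : 'I_NB -> X -> R)
  (Pi : 'I_NB -> X -> 'M[complex R]_n) (rho : 'M[complex R]_n) :
  (forall y : X, spectral_resolution (H y) (fun j => E j y) (fun j => Pi j y)) ->
  psd rho ->
  (* the eigenvalue vector E(x) is a random vector *)
  measurable_fun setT (fun w : Omega => [tuple E j (x w) | j < NB]) ->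
  (* (i) its law is absolutely continuous w.r.t. Lebesgue measure on R^NB *)
  (forall A : set (NB.-tuple R), measurable A -> lebesgue_null A ->
     P ((fun w : Omega => [tuple E j (x w) | j < NB]) @^-1` A) = 0%E) ->
  (* (ii) tr Pi_j(x) and d_j(x) = tr(rho Pi_j(x)) do not depend on x *)
  (forall j (y y' : X), \tr (Pi j y) = \tr (Pi j y')) ->
  (forall j (y y' : X), \tr (rho *m Pi j y) = \tr (rho *m Pi j y')) ->
  forall m : nat,
  let a := fun (w : Omega) (t : R) =>
    cabs_pow (chi rho (fun j => E j (x w)) (fun j => Pi j (x w)) t) (2 * m) in
  let F := fun t : R => Rintegral P setT (fun w => a w t) in
  exists L : R,
    [/\ F t @[t --> +oo] --> L,
        tavg_T F T @[T --> +oo] --> L,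
        (\int[P]_w (tavg (a w))%:E = L%:E)%E
      & {ae P, forall w, tavg_T (a w) T @[T --> +oo] --> L}].
Proof.
move=> _ _ mV acV _ drho m a F.
pose V w := [tuple E j (x w) | j < NB].
have [w0 _] : exists w0 : Omega, True.
  apply: contrapT => /forallNP noOmega.
  have /eqP := @probability_setT _ _ _ P.
  rewrite (_ : setT = set0); first by rewrite measure0 eq_sym onee_eq0.
  by apply/seteqP; split => // w _; have := noOmega w.
have [s sE] := is_trig_cabs_pow (fun j => \tr (rho *m Pi j (x w0))) m.
have aE w : a w = trig_eval s (V w).
  apply/funext => t; rewrite -(sE (V w) t) /a chi_expand.
  under eq_bigr do rewrite (drho _ (x w) (x w0)).
  by under [in RHS]eq_bigr do rewrite tnth_mktuple.
have FE : F = fun t => Rintegral P setT (fun w => trig_eval s (V w) t).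
  by apply/funext => t; apply: eq_Rintegral => w _; rewrite aE.
exists (trig_limit s); split.
- by rewrite FE; exact: cvg_Rintegral_trig.
- by rewrite FE; exact: tavg_Rintegral_trig.
- rewrite -(integral_trig_mean mV acV s); apply: eq_integral => w _.
  by congr EFin; rewrite aE; apply/cvg_lim => //; exact: tavg_trig.
- apply: filterS (trig_mean_ae mV acV s) => w <-; rewrite aE; exact: tavg_trig.
Qed.
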